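(* For all integers $k\geq 6$ and $n\geq 2$, $$\operatorname{GM}_{k}(K_{3}:nK_{2})\leq (2n-1)!!.$$
   Context: All graphs are finite, simple and undirected; colorings are edge-colorings. $nK_2$ is a matching with $n$ edges. A $k$-coloring is exact if all $k$ colors are used at least once. A colored graph is rainbow if no two of its edges have the same color, and monochromatic if all its edges have the same color. Copies of a graph are counted as (not necessarily induced) subgraphs. $(2n-1)!!=(2n-1)(2n-3)\cdots 3\cdot 1$. The Gallai-Ramsey number $\operatorname{gr}_k(G:H)$ is the minimum integer $m$ with $\binom{m}{2}\geq k$ such that for every $N\geq m$, every exact $k$-coloring of $K_N$ contains a rainbow copy of $G$ or a monochromatic copy of $H$. The Gallai-Ramsey multiplicity $\operatorname{GM}_k(G:H)$ (also written $\operatorname{GM}_k(G,H)$) is the minimum, over all exact $k$-colorings of $K_{\operatorname{gr}_k(G:H)}$, of the total number of rainbow copies of $G$ and monochromatic copies of $H$. *)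

(* Defs.v *)
From mathcomp Require Import all_boot.

Set Implicit Arguments.
Unset Strict Implicit.
Unset Printing Implicit Defensive.

Record sgraph := SGraph {
  vertex :> finType;
  adj : rel vertex;
  adj_sym : symmetric adj;
  adj_irr : irreflexive adj
}.

Definition complete_rel (T : finType) : rel T := fun x y => x != y.

Fact complete_sym (T : finType) : symmetric (@complete_rel T).
Proof. by move=> x y; rewrite /complete_rel eq_sym. Qed.

Fact complete_irr (T : finType) : irreflexive (@complete_rel T).
Proof. by move=> x; rewrite /complete_rel eqxx. Qed.

Definition complete_graph (n : nat) : sgraph :=
  SGraph (@complete_sym 'I_n) (@complete_irr 'I_n).

(* The i-th edge of the matching joins (i, false) to (i, true). *)
Definition matching_rel (n : nat) : rel ('I_n * bool)%type :=
  fun x y => (x.1 == y.1) && (x.2 != y.2).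

Fact matching_sym (n : nat) : symmetric (@matching_rel n).
Proof. by move=> x y; rewrite /matching_rel eq_sym [x.2 == _]eq_sym. Qed.

Fact matching_irr (n : nat) : irreflexive (@matching_rel n).
Proof. by move=> x; rewrite /matching_rel !eqxx. Qed.

Definition matching (n : nat) : sgraph :=
  SGraph (@matching_sym n) (@matching_irr n).

Definition edge (N : nat) := {e : {set 'I_N} | #|e| == 2}.

Definition coloring (k N : nat) := {ffun edge N -> 'I_k}.

Definition exact (k N : nat) (c : coloring k N) : Prop :=
  forall i : 'I_k, exists e : edge N, c e = i.

Definition subgraph (N : nat) := ({set 'I_N} * {set edge N})%type.

Definition image_graph (G : sgraph) (N : nat) (f : {ffun G -> 'I_N}) :
    subgraph N :=
  ([set f x | x : G],
   [set e : edge N | [exists x, exists y, adj x y && (val e == [set f x; f y])]]).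

(* A copy is a subgraph, not an embedding: embeddings of G with the same image
   are counted once. *)
Definition copies (G : sgraph) (N : nat) : {set subgraph N} :=
  [set image_graph f | f : {ffun G -> 'I_N} & injectiveb f].

Definition rainbow (k N : nat) (c : coloring k N) (S : subgraph N) : bool :=
  [forall e in S.2, forall e' in S.2, (c e == c e') ==> (e == e')].

Definition monochromatic (k N : nat) (c : coloring k N) (S : subgraph N) :
    bool :=
  [forall e in S.2, forall e' in S.2, c e == c e'].

Definition rainbow_copies (G : sgraph) (k N : nat) (c : coloring k N) :
    {set subgraph N} :=
  [set S in copies G N | rainbow c S].

Definition mono_copies (H : sgraph) (k N : nat) (c : coloring k N) :
    {set subgraph N} :=
  [set S in copies H N | monochromatic c S].

Definition gr_bound (k : nat) (G H : sgraph) (m : nat) : Prop :=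
  k <= 'C(m, 2) /\
  forall N : nat, m <= N -> forall c : coloring k N, exact c ->
    rainbow_copies G c != set0 \/ mono_copies H c != set0.

(* gr_k(G : H) = m *)
Definition is_gr (k : nat) (G H : sgraph) (m : nat) : Prop :=
  gr_bound k G H m /\ forall m' : nat, gr_bound k G H m' -> m <= m'.

Definition num_copies (G H : sgraph) (k N : nat) (c : coloring k N) : nat :=
  #|rainbow_copies G c| + #|mono_copies H c|.

(* GM_k(G : H) = g.  The numbers gr_k and GM_k are given by their graphs, so
   that [is_GM] also asserts that gr_k(G : H) exists. *)
Definition is_GM (k : nat) (G H : sgraph) (g : nat) : Prop :=
  exists m : nat, is_gr k G H m /\
    (exists c : coloring k m, exact c /\ num_copies G H c = g) /\
    (forall c : coloring k m, exact c -> g <= num_copies G H c).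

Fixpoint double_factorial (m : nat) : nat :=
  if m is m'.+2 then m * double_factorial m' else 1.

(* Main.v *)
Require Import Defs.
From mathcomp Require Import all_boot.
From mathcomp Require Import zify.

Set Implicit Arguments.
Unset Strict Implicit.
Unset Printing Implicit Defensive.

(* The Gallai-Ramsey number is m = (k+1)(n-1) + 2.  For the lower bound, and for
   the bound on the multiplicity, take a clique in one color and add k-1 layers
   of n-1 vertices, where an edge gets the color of its later layer: there is no
   rainbow triangle, and a monochromatic nK_2 lies in the clique.  A clique on
   2n-1 vertices leaves none, and a clique on 2n vertices, which gives K_m,
   leaves its (2n-1)!! perfect matchings.

   For the upper bound, let nu_i be the matching number of color i in a coloring
   of a complete graph on V without rainbow triangle; then
   |V| <= 1 + max_i nu_i + sum_i nu_i, by induction on |V|.  Gallai's theorem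
   gives a partition of V into homogeneous classes with only two colors a, b
   between them.  If some class X contains half of V, matchings of X extend
   greedily by the edges leaving X.  Otherwise the edges between classes have a
   near-perfect matching, so nu_a + nu_b >= |V|/2 rounded down, and we are done
   if the maximum is attained outside {a, b}.  If it is attained only in {a, b},
   delete an edge, or a path with two edges, in the maximal colors. *)

(** * Matching numbers *)

Section MatchingNumber.

Variable T : finType.
Implicit Types (e : rel T) (V W : {set T}).

(** Deleting both ends of each chosen edge makes disjointness automatic and lets every proof go by
    induction on [m]. *)
Fixpoint has_matching e m V : bool :=
  if m is m'.+1 then
    [exists x in V, exists y in V,
       [&& x != y, e x y & has_matching e m' (V :\ x :\ y)]]
  else true.

Lemma has_matchingSP e m V :
  reflect (exists x y, [/\ x \in V, y \in V, x != y, e x y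
                         & has_matching e m (V :\ x :\ y)])
          (has_matching e m.+1 V).
Proof.
apply: (iffP exists_inP) => [[x xV /exists_inP[y yV /and3P[*]]]|].
  by exists x, y.
move=> [x [y [xV yV xy exy h]]]; exists x => //.
by apply/exists_inP; exists y => //; apply/and3P.
Qed.

Lemma has_matchingS e m V W : V \subset W ->
  has_matching e m V -> has_matching e m W.
Proof.
elim: m V W => // m IH V W sVW /has_matchingSP[x [y [xV yV xy exy h]]].
apply/has_matchingSP; exists x, y; split; rewrite ?(subsetP sVW) //.
by apply: IH h; rewrite !setSD.
Qed.

Lemma has_matching_le e m m' V : m' <= m ->
  has_matching e m V -> has_matching e m' V.
Proof.
elim: m m' V => [|m IH] [|m'] V // le_m /has_matchingSP[x [y [*]]].
by apply/has_matchingSP; exists x, y; split=> //; apply: IH.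
Qed.

Lemma cardsD2 V x y : x \in V -> y \in V -> x != y ->
  #|V| = #|V :\ x :\ y|.+2.
Proof.
move=> xV yV xy; rewrite (cardsD1 x V) xV (cardsD1 y (V :\ x)).
by rewrite !inE eq_sym xy yV.
Qed.

(** Isolates the ends of the edges, so that the vertices outside [W] stay free for further edges. *)
Lemma has_matching_support e m V : has_matching e m V ->
  exists W, [/\ W \subset V, #|W| = m.*2 & has_matching e m W].
Proof.
elim: m V => [|m IH] V; first by exists set0; rewrite sub0set cards0.
move=> /has_matchingSP[x [y [xV yV xy exy /IH[W [sW cW hW]]]]].
have xW : x \notin W.
  by apply/negP => /(subsetP sW); rewrite !inE eqxx andbF.
have yW : y \notin W by apply/negP => /(subsetP sW); rewrite !inE eqxx.
exists (x |: (y |: W)); split.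
- rewrite !subUset !sub1set xV yV /=; apply: subset_trans sW _.
  by apply: subset_trans (subsetDl _ _) (subsetDl _ _).
- by rewrite !cardsU1 !inE negb_or xy xW yW cW.
apply/has_matchingSP; exists x, y; rewrite !inE !eqxx orbT; split=> //.
apply: has_matchingS hW; apply/subsetP=> z zW; rewrite !inE zW !orbT andbT.
by apply/andP; split; [apply: contraNneq yW|apply: contraNneq xW] => <-.
Qed.

Lemma has_matching_card e m V : has_matching e m V -> m.*2 <= #|V|.
Proof. by move=> /has_matching_support[W [sW <- _]]; apply: subset_leq_card. Qed.

Lemma has_matchingU e m m' V W : [disjoint V & W] ->
  has_matching e m V -> has_matching e m' W ->
  has_matching e (m + m') (V :|: W).
Proof.
elim: m V => [|m IH] V dVW hV hW.
  by apply: has_matchingS hW; apply: subsetUr.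
have /has_matchingSP[x [y [xV yV xy exy h]]] := hV.
apply/has_matchingSP; exists x, y; rewrite !inE xV yV; split=> //.
have sV' : V :\ x :\ y \subset V.
  by apply: subset_trans (subsetDl _ _) (subsetDl _ _).
have := IH _ (disjointWl sV' dVW) h hW; apply: has_matchingS.
apply/subsetP=> z; rewrite !inE => /orP[/and3P[-> -> ->]//|zW].
have zV : z \notin V by rewrite (disjointFl dVW zW).
by rewrite zW orbT andbT; apply/andP; split; apply: contraNneq zV => ->.
Qed.

Lemma has_matching_bipartite e m V W : [disjoint V & W] ->
  {in V & W, forall x y, e x y} -> m <= #|V| -> m <= #|W| ->
  has_matching e m (V :|: W).
Proof.
elim: m V W => // m IH V W dVW eVW mV mW.
have [x xV] : exists x, x \in V by apply/card_gt0P; lia.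
have [y yW] : exists y, y \in W by apply/card_gt0P; lia.
have xW : x \notin W by rewrite (disjointFr dVW xV).
have yV : y \notin V by rewrite (disjointFl dVW yW).
apply/has_matchingSP; exists x, y; rewrite !inE xV yW orbT eVW //.
split=> //; first by apply: contraNneq xW => ->.
have := cardsD1 x V; have := cardsD1 y W; rewrite xV yW => cW cV.
have : has_matching e m ((V :\ x) :|: (W :\ y)).
  apply: IH; [|by move=> u v /setD1P[_ ?] /setD1P[_ ?]; apply: eVW|lia|lia].
  exact: disjointW (subsetDl _ _) (subsetDl _ _) dVW.
apply: has_matchingS; apply/subsetP=> z; rewrite !inE => /orP[/andP[zx zV]|].
  by rewrite zx zV !andbT; apply: contraNneq yV => <-.
move=> /andP[-> zW]; rewrite zW orbT andbT /=.
by apply: contraNneq xW => <-.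
Qed.

Lemma has_matching_or e1 e2 m V :
  has_matching [rel x y | e1 x y || e2 x y] m V ->
  exists m1 m2, [/\ m = m1 + m2, has_matching e1 m1 V & has_matching e2 m2 V].
Proof.
elim: m V => [|m IH] V; first by exists 0, 0.
move=> /has_matchingSP[x [y [xV yV xy exy /IH[m1 [m2 [-> h1 h2]]]]]].
have sV' : V :\ x :\ y \subset V.
  by apply: subset_trans (subsetDl _ _) (subsetDl _ _).
case/orP: exy => exy; [exists m1.+1, m2|exists m1, m2.+1].
  split=> //; last exact: has_matchingS h2.
  by apply/has_matchingSP; exists x, y.
split; [lia|exact: has_matchingS h1|].
by apply/has_matchingSP; exists x, y.
Qed.

Definition matching_number e V := \max_(m < #|V|.+1 | has_matching e m V) m.

Lemma matching_numberE e m V : has_matching e m V = (m <= matching_number e V).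
Proof.
have hnu : has_matching e (matching_number e V) V.
  rewrite /matching_number.
  case: (@eq_bigmax_cond _ [pred m : 'I_#|V|.+1 | has_matching e m V]
           (fun m => nat_of_ord m)).
    by apply/card_gt0P; exists ord0.
  by move=> i hi ->.
apply/idP/idP => [h|h]; last exact: has_matching_le h hnu.
have lt_m : m < #|V|.+1 by have := has_matching_card h; lia.
exact: (@leq_bigmax_cond _ (fun i : 'I_#|V|.+1 => has_matching e i V)
          (fun i => nat_of_ord i) (Ordinal lt_m)).
Qed.

Lemma matching_numberS e V W : V \subset W ->
  matching_number e V <= matching_number e W.
Proof.
by move=> sVW; rewrite -matching_numberE; apply: has_matchingS sVW _;
   rewrite matching_numberE.
Qed.

Lemma matching_number_setD_edge e V W x y :
  x \in V -> y \in V -> x != y -> e x y -> W \subset V :\ x :\ y ->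
  matching_number e W < matching_number e V.
Proof.
move=> xV yV xy exy sW; rewrite -matching_numberE; apply/has_matchingSP.
by exists x, y; split=> //; apply: has_matchingS sW _; rewrite matching_numberE.
Qed.

Lemma matching_number_join e V W : [disjoint V & W] ->
    {in V & W, forall x y, e x y} -> #|W| <= #|V| ->
  let nu := matching_number e (V :|: W) in
  #|W| <= nu /\
  (matching_number e V + #|W| <= nu \/ #|V| + #|W| <= nu.*2.+1).
Proof.
move=> dVW eVW leWV nu.
have key m : m <= matching_number e V -> m.*2 + #|W| <= #|V| -> m + #|W| <= nu.
  rewrite -matching_numberE => /has_matching_support[U [sU cU hU]] le.
  rewrite -matching_numberE.
  have -> : V :|: W = U :|: ((V :\: U) :|: W).
    by rewrite setUA -[in LHS](setID V U) (setIidPr sU).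
  apply: has_matchingU => //; first last.
    apply: has_matching_bipartite => //; last by rewrite cardsD (setIidPr sU); lia.
      exact: disjointWl (subsetDl _ _) dVW.
    by move=> x y /setDP[xV _]; apply: eVW.
  rewrite -setI_eq0 setIUr (disjoint_setI0 (disjointWl sU dVW)) setU0.
  by rewrite setIDA setIC -setIDA setDv setI0.
split; first by apply: (key 0) => //; lia.
have [le|lt] := leqP ((matching_number e V).*2 + #|W|) #|V|.
  by left; apply: key.
by right; have := key (#|V| - #|W|)./2; lia.
Qed.

(* Remove an edge joining a largest class to any other class: a second class
   that could still be too large is the only other one. *)
Lemma has_matching_multipartite (L : eqType) (p : T -> L) e V :
  {in V &, forall x y, p x != p y -> e x y} ->
  {in V, forall x, #|[set y in V | p y == p x]|.*2 <= #|V|.+1} ->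
  has_matching e #|V|./2 V.
Proof.
have [n] := ubnP #|V|; elim: n V => // n IH V ltn eV half.
have [/eqP V0|/card_gt0P[x0 x0V]] := posnP #|V|.
  by rewrite (eqP V0).
case: (arg_maxnP (fun x => #|[set y in V | p y == p x]|) x0V) => x /= xV xmax.
have [le1|gt1] := leqP #|V| 1; first by have -> : #|V|./2 = 0 by lia.
have : [set y in V | p y == p x] \proper V.
  rewrite properEcard; have := half x xV => ?; apply/andP; split; last by lia.
  by apply/subsetP=> y; rewrite inE => /andP[].
case/properP=> _ [y yV]; rewrite inE yV /= => pyx.
have xy : x != y by apply: contraNneq pyx => ->.
have cV := cardsD2 xV yV xy.
rewrite cV /=; apply/has_matchingSP; exists x, y; split=> //.
  by apply: eV; rewrite // eq_sym.
apply: IH; first lia.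
  by move=> u v /setD1P[_ /setD1P[_ uV]] /setD1P[_ /setD1P[_ vV]]; apply: eV.
move=> z /setD1P[zy /setD1P[zx zV]].
set Cz := [set u in _ | _].
have sC : Cz \subset [set u in V | p u == p z].
  by apply/subsetP=> u; rewrite !inE -!andbA => /and4P[_ _ -> ->].
have cC (w : T) : w \in [set x; y] -> p w == p z ->
    #|Cz| < #|[set u in V | p u == p z]|.
  move=> wxy pw; apply: proper_card; rewrite properE sC /=.
  apply/subsetPn; exists w; rewrite ?inE ?pw ?andbT; move: wxy; rewrite !inE.
    by case/orP=> /eqP->.
  by case/orP=> /eqP->; rewrite !eqxx ?andbF.
have hz := half z zV.
(* The bound required of [Cz] is one less than the bound [half] gives for the class of [z], measured
   by twice the size. A class that contains [x] or [y] has lost a vertex, which is enough. *)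
have [pxz|pxz] := boolP (p x == p z).
  have := cC x; rewrite !inE eqxx => /(_ isT pxz); lia.
have [pyz|pyz] := boolP (p y == p z).
  have := cC y; rewrite !inE eqxx orbT => /(_ isT pyz); lia.
have := xmax z zV => /= xz.
(* Otherwise the class of [z], the class of [x] and the vertex [y] are disjoint. As the class of [x]
   is largest, twice the class of [z] is at most |V| - 1. *)
suff : #|y |: ([set u in V | p u == p z] :|: [set u in V | p u == p x])| <= #|V|.
  rewrite cardsU1 cardsU !inE yV /= (negPf pyz) (negPf pyx) /=.
  have -> : [set u in V | p u == p z] :&: [set u in V | p u == p x] = set0.
    apply/setP=> u; rewrite !inE; apply/negbTE/negP.
    move=> /andP[/andP[_ /eqP puz] /andP[_ /eqP pux]].
    by rewrite -pux puz eqxx in pxz.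
  rewrite cards0; have := subset_leq_card sC; lia.
apply: subset_leq_card; rewrite !subUset sub1set yV /=.
by apply/andP; split; apply/subsetP=> u; rewrite inE => /andP[].
Qed.

End MatchingNumber.

(** * Colorings without rainbow triangle *)

Section GallaiColorings.

Variables (T C : finType) (col : T -> T -> C).
Hypothesis col_sym : forall x y, col x y = col y x.
Hypothesis no_rainbow : forall x y z, x != y -> x != z -> y != z ->
  col x y != col x z -> col y z = col x y \/ col y z = col x z.

Implicit Types (a b : C) (B V W : {set T}) (x y z : T).

(** Its components inside [V] are the classes of a Gallai partition with [a] and [b] between
    them. *)
Definition avoids a b V : rel T :=
  fun x y => [&& x \in V, y \in V, col x y != a & col x y != b].

Lemma avoids_connect_sym a b V : connect_sym (avoids a b V).
Proof.
apply: sym_connect_sym => x y.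
by rewrite /avoids (col_sym x y) andbCA.
Qed.

Lemma color_across a b V x y : x \in V -> y \in V ->
  ~~ connect (avoids a b V) x y -> col x y = a \/ col x y = b.
Proof.
move=> xV yV /negP nc; have [->|na] := eqVneq (col x y) a; first by left.
right; apply/eqP/negPn/negP => nb; apply/nc/connect1.
by rewrite /avoids xV yV na nb.
Qed.

Lemma not_connect_neq (e : rel T) x y : ~~ connect e x y -> x != y.
Proof. by apply: contraNneq => ->; apply: connect0. Qed.

(** Walk along a path from [x] to [x']: each edge has a color outside {a, b}, while both of its ends
    see [y] in [a] or [b]. If the two colors at [y] differed, the triangle would be rainbow. *)
Lemma component_homogeneous a b V x x' y : x \in V -> y \in V ->
  connect (avoids a b V) x x' -> ~~ connect (avoids a b V) x y ->
  col x y = col x' y.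
Proof.
move=> xV yV /connectP[p]; elim: p x xV => [|z p IH] x xV /=.
  by move=> _ ->.
move=> /andP[exz pz] lastp nxy; have /and4P[_ zV na nb] := exz.
have nzy : ~~ connect (avoids a b V) z y.
  by apply: contra nxy; apply: connect_trans (connect1 _).
rewrite -(IH z zV pz lastp nzy).
have [->//|xz] := eqVneq x z.
have cxy := color_across xV yV nxy; have czy := color_across zV yV nzy.
apply/eqP/negPn/negP => ne.
have [yx yz] : y != x /\ y != z by rewrite eq_sym (not_connect_neq nxy)
  eq_sym (not_connect_neq nzy).
have := no_rainbow yx yz xz; rewrite !(col_sym y) => /(_ ne) [] e.
  by case: cxy => exy; rewrite e exy eqxx in na nb.
by case: czy => ezy; rewrite e ezy eqxx in na nb.
Qed.

Lemma closed_disconnected (e : rel T) (A : {set T}) x y : connect_sym e ->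
  (forall u v, e u v -> u \in A -> v \in A) -> x \in A -> y \notin A ->
  ~~ connect e x y.
Proof.
move=> se cA xA; apply: contra => /connectP[p]; elim: p x xA => [|z p IH] x xA /=.
  by move=> _ ->.
by move=> /andP[exz pz]; apply: IH pz; apply: cA exz xA.
Qed.

(* Gallai's theorem: the classes of [connect (avoids a b V)] are homogeneous and
   only the colors [a] and [b] occur between them.  A new vertex [v] either
   leaves some class of the old partition isolated, or sees one color [d] in
   every class and at most one further color, and is then itself a class for
   these two colors. *)
Lemma gallai_partition V : 1 < #|V| ->
  exists a b x y, [/\ x \in V, y \in V & ~~ connect (avoids a b V) x y].
Proof.
have [n] := ubnP #|V|; elim: n V => // n IH V ltn gt1.
have [v vV] : exists v, v \in V by apply/card_gt0P; lia.
have cV := cardsD1 v V; rewrite vV in cV.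
have isolated a b w : w \in V :\ v ->
    {in V :\ v, forall z, col v z = a \/ col v z = b} ->
    exists a b x y, [/\ x \in V, y \in V & ~~ connect (avoids a b V) x y].
  move=> wV' h; have /setD1P[wv wV] := wV'.
  exists a, b, v, w; split=> //.
  apply: (@closed_disconnected _ [set v]); rewrite ?inE //.
    exact: avoids_connect_sym.
  move=> x y /and4P[xV yV na nb] /set1P xv; rewrite {x}xv in xV na nb *.
  rewrite inE; apply/negPn/negP => yv.
  by case: (h y); rewrite ?inE ?yv // => e; rewrite e eqxx in na nb.
have [w wV'] : exists w, w \in V :\ v by apply/card_gt0P; lia.
have [le1|gt1'] := leqP #|V :\ v| 1.
  have /cards1P[u Vu] : #|V :\ v| == 1 by lia.
  apply: (isolated (col v w) (col v w) w) => // z.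
  by move: wV'; rewrite Vu => /set1P-> /set1P->; left.
have [a [b [x [y [xV' yV' nxy]]]]] : exists a b x y, [/\ x \in V :\ v,
    y \in V :\ v & ~~ connect (avoids a b (V :\ v)) x y] by apply: IH; lia.
set V' := V :\ v in cV gt1' xV' yV' nxy isolated wV' *.
set r := avoids a b V' in nxy *.
have rsym : connect_sym r by apply: avoids_connect_sym.
pose ab z := (col v z == a) || (col v z == b).
(* If [v] sees some old class only in [a] and [b], that class remains a union of components after
   [v] is added. *)
have [/existsP[z /andP[zV' /forallP zab]]|] :=
  boolP [exists z, (z \in V') && [forall w, (w \in V') && connect r z w ==> ab w]].
  have /setD1P[zv zV] := zV'.
  exists a, b, z, v; split=> //.
  apply: (@closed_disconnected _ [set u in V' | connect r z u]).
  - exact: avoids_connect_sym.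
  - move=> u u' /and4P[uV u'V na nb]; rewrite !inE => /andP[/andP[uv _] zu].
    have u'v : u' != v.
      apply/eqP => u'v; have := zab u; rewrite !inE uv uV zu /= /ab.
      by rewrite (col_sym v u) -u'v (negPf na) (negPf nb).
    rewrite u'v u'V; apply: connect_trans zu (connect1 _).
    by rewrite /r /avoids !inE uv uV u'v u'V na nb.
  - by rewrite inE zV' connect0.
  - by rewrite !inE eqxx.
rewrite negb_exists => /forallP nob.
have rep z : z \in V' -> exists z', [/\ z' \in V', connect r z z' & ~~ ab z'].
  move=> zV'; have := nob z; rewrite zV' /= negb_forall => /existsP[z'].
  by rewrite negb_imply => /andP[/andP[? ?] ?]; exists z'.
have vV' z : z \in V' -> v != z.
  by move=> /setD1P[zv _]; rewrite eq_sym.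
have other z : z \in V' -> exists z', z' \in V' /\ ~~ connect r z z'.
  move=> zV'; have [zx|zx] := boolP (connect r z x); last by exists x.
  exists y; split=> //; apply: contra nxy => zy.
  by apply: connect_trans zy; rewrite rsym.
(* The edge [z z'] has color [a] or [b], but neither edge from [v] does; avoiding a rainbow triangle
   forces these two to agree. *)
have repc z z' : z \in V' -> z' \in V' -> ~~ ab z -> ~~ ab z' ->
    ~~ connect r z z' -> col v z = col v z'.
  move=> zV' z'V' /norP[nza nzb] /norP[nz'a nz'b] nc.
  apply/eqP/negPn/negP => ne.
  have := no_rainbow (vV' z zV') (vV' z' z'V') (not_connect_neq nc) ne.
  by case: (color_across zV' z'V' nc) => -> [] e;
    rewrite -e eqxx in nza nzb nz'a nz'b.
have [x0 [x0V' xx0 nabx0]] := rep x xV'.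
have [y0 [y0V' yy0 naby0]] := rep y yV'.
have nx0y0 : ~~ connect r x0 y0.
  apply: contra nxy => x0y0; apply: connect_trans xx0 _.
  by apply: connect_trans x0y0 _; rewrite rsym.
set d := col v x0.
(* A vertex in the class of [x0] cannot be compared with [x0] itself, so it is compared with [y0],
   which lies in another class. *)
have cd z : z \in V' -> ~~ ab z -> col v z = d.
  move=> zV' nz; have [zx|zx] := boolP (connect r z x0); last exact: repc.
  rewrite (repc z y0) // /d ?(repc x0 y0) //.
  by apply: contra nx0y0; apply: connect_trans; rewrite rsym.
have out z t : z \in V' -> t \in V' -> ~~ connect r z t -> ~~ ab t -> ab z ->
    col z t = col v z.
  move=> zV' tV' nc nt abz; have vt := cd t tV' nt.
  have ne : col v z != col v t.
    by apply: contraNneq nt; rewrite /ab => <-.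
  case: (no_rainbow (vV' z zV') (vV' t tV') (not_connect_neq nc) ne) => //.
  by move=> e; case/norP: nt; case: (color_across zV' tV' nc);
    rewrite -e => ->; rewrite eqxx.
(* In one class, compare both vertices with the same [t] outside it. In two classes, take [t] and
   [s] in the classes of [z] and [w'] with colors outside {a, b} at [v]; the colors of [v z], [z s],
   [t s], [w' t] and [v w'] then coincide. *)
have uniq_ab z w' : z \in V' -> w' \in V' -> ab z -> ab w' -> col v z = col v w'.
  move=> zV' w'V' abz abw'.
  have [zw|zw] := boolP (connect r z w').
    have [u [uV' nzu]] := other z zV'; have [t [tV' ut nt]] := rep u uV'.
    have nzt : ~~ connect r z t.
      by apply: contra nzu => zt; apply: connect_trans zt _; rewrite rsym.
    have nwt : ~~ connect r w' t by apply: contra nzt; apply: connect_trans.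
    by rewrite -(out z t) // -(out w' t) //; apply: component_homogeneous zw nzt.
  have [t [tV' zt nt]] := rep z zV'; have [s [sV' ws ns]] := rep w' w'V'.
  have nzs : ~~ connect r z s.
    by apply: contra zw => zs; apply: connect_trans zs _; rewrite rsym.
  have nwt : ~~ connect r w' t.
    by apply: contra zw => wt; apply: connect_trans zt _; rewrite rsym.
  have nst : ~~ connect r t s by apply: contra nzs; apply: connect_trans.
  rewrite -(out z s) // -(out w' t) // (component_homogeneous _ _ zt nzs) //.
  rewrite (component_homogeneous _ _ ws nwt) // col_sym //.
have [/existsP[z /andP[zV' abz]]|/existsPn nab] :=
    boolP [exists z, (z \in V') && ab z].
  apply: (isolated d (col v z) w) => // u uV'.
  by have [abu|nabu] := boolP (ab u); [right; apply: uniq_ab|left; apply: cd].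
apply: (isolated d d w) => // u uV'; left; apply: cd => //.
by have := nab u; rewrite uV'.
Qed.

(** * The matching bound for colorings without rainbow triangle *)

Definition color_matching (i : C) V :=
  matching_number (fun x y => col x y == i) V.

(* Stating the bound for some color is the same as stating it for the color with
   the largest matching number. *)
Definition cockayne_lorimer V :=
  exists i, #|V| <= (color_matching i V + \sum_j color_matching j V).+1.

(** Sort the vertices outside [B] into sets [R i] by their color to [B], and apply
    [matching_number_join] to [B] and each [R i]. If some color i gets |B| + |R i| <= 2 nu_i + 1,
    the bounds |R j| <= nu_j for the other colors finish. Otherwise every nu_i grows by |R i| from
    [B] to [V], and the bound for [B] carries over. *)
Lemma cockayne_lorimer_module V B x0 : x0 \in B -> B \subset V ->
  {in B & V :\: B, forall x y, col x y = col x0 y} -> #|V| <= #|B|.*2 ->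
  cockayne_lorimer B -> cockayne_lorimer V.
Proof.
move=> x0B sBV hom half [i0 hi0].
pose R i := [set y in V :\: B | col x0 y == i].
have cR : #|V| = #|B| + \sum_i #|R i|.
  rewrite -(cardsID B V) (setIidPr sBV); congr addn.
  rewrite -sum1_card (partition_big (col x0) xpredT) //=.
  by apply: eq_bigr => i _; rewrite -sum1_card; apply: eq_bigl => y; rewrite !inE.
have sR i : R i \subset V :\: B by apply/subsetP=> y; rewrite inE => /andP[].
have joinR i : #|R i| <= color_matching i V /\
    (color_matching i B + #|R i| <= color_matching i V \/
     #|B| + #|R i| <= (color_matching i V).*2.+1).
  have sU : B :|: R i \subset V.
    by rewrite subUset sBV (subset_trans (sR i)) ?subsetDl.
  have le := matching_numberS (fun x y => col x y == i) sU.
  have [] := @matching_number_join _ (fun x y => col x y == i) B (R i).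
  - apply: disjointWr (sR i) _; rewrite -setI_eq0 setIDA setIC -setIDA.
    by rewrite setDv setI0.
  - move=> x y xB yR; have /setIdP[yV /eqP <-] := yR.
    by apply/eqP; apply: hom.
  - by move: cR; rewrite (bigD1 i) //=; lia.
  rewrite /color_matching => h1 h2; split; first by lia.
  by case: h2 => h2; [left|right]; lia.
have [/existsP[i hi]|/existsPn h] :=
    boolP [exists i, #|B| + #|R i| <= (color_matching i V).*2.+1].
  exists i; rewrite cR (bigD1 i) //= (bigD1 i (F := fun j => color_matching j V)) //=.
  have : \sum_(j | j != i) #|R j| <= \sum_(j | j != i) color_matching j V.
    by apply: leq_sum => j _; case: (joinR j).
  by lia.
have h' i : color_matching i B + #|R i| <= color_matching i V.
  by case: (joinR i) => _ []// hi; have := h i; rewrite hi.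
exists i0; have : \sum_i color_matching i B + \sum_i #|R i|
    <= \sum_i color_matching i V.
  by rewrite -big_split; apply: leq_sum => i _; apply: h'.
by have := h' i0; lia.
Qed.

(** Every vertex has an edge of color [a] or [b] to another class. If the given edges [p q] and
    [s t] do not produce the path this way, then [p p'] has color [a] and [s s'] has color [b]. One
    of [p], [p'] is in another class than [s], and its edge to [s] completes the path. *)
Lemma adjacent_edges a b V x y : x \in V -> y \in V ->
  ~~ connect (avoids a b V) x y -> a != b ->
  0 < color_matching a V -> 0 < color_matching b V ->
  exists u v w, [/\ u \in V, v \in V & w \in V] /\
    [/\ u != v, u != w, v != w, col u v = a & col u w = b].
Proof.
set r := avoids a b V => xV yV nxy ab.
have rsym : connect_sym r by apply: avoids_connect_sym.
rewrite -2!matching_numberE.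
move=> /has_matchingSP[p [q [pV qV pq /eqP cpq _]]].
move=> /has_matchingSP[s [t [sV tV st /eqP cst _]]].
have meet u v w : u \in V -> v \in V -> w \in V -> u != v -> u != w ->
    col u v = a -> col u w = b -> exists u v w,
    [/\ u \in V, v \in V & w \in V] /\
    [/\ u != v, u != w, v != w, col u v = a & col u w = b].
  move=> uV vV wV uv uw cuv cuw; exists u, v, w; split=> //; split=> //.
  by apply: contraNneq ab => e; rewrite -cuv -cuw e.
have other z : exists z', z' \in V /\ ~~ connect r z z'.
  have [zx|zx] := boolP (connect r z x); last by exists x.
  exists y; split=> //; apply: contra nxy => zy.
  by apply: connect_trans zy; rewrite rsym.
have [p' [p'V npp']] := other p.
have pp' := not_connect_neq npp'.
have [cpp'|cpp'] := color_across pV p'V npp'; last exact: (meet p q p').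
have [s' [s'V nss']] := other s.
have ss' := not_connect_neq nss'.
have [css'|css'] := color_across sV s'V nss'; first exact: (meet s s' t).
have key z z' : z \in V -> z' \in V -> z != z' -> col z z' = a ->
    ~~ connect r z s -> exists u v w,
    [/\ u \in V, v \in V & w \in V] /\
    [/\ u != v, u != w, v != w, col u v = a & col u w = b].
  move=> zV z'V zz' czz' nzs; have zs := not_connect_neq nzs.
  have [czs|czs] := color_across zV sV nzs; last exact: (meet z z' s).
  by apply: (meet s z s') => //; rewrite 1?eq_sym 1?col_sym.
have [ps|ps] := boolP (connect r p s); last exact: (key p p').
apply: (key p' p) => //; rewrite 1?eq_sym 1?col_sym //.
by apply: contra npp' => p's; apply: connect_trans ps _; rewrite rsym.
Qed.

Lemma cockayne_lorimer_gallai (i0 : C) V : cockayne_lorimer V.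
Proof.
have [n] := ubnP #|V|; elim: n V => // n IH V ltn.
(* Even for at most one vertex a color must be named; [i0] is that witness. *)
have [le1|gt1] := leqP #|V| 1; first by exists i0; lia.
have [a [b [x [y [xV yV nxy]]]]] := gallai_partition gt1.
set r := avoids a b V in nxy.
have rsym : connect_sym r by apply: avoids_connect_sym.
pose cls z := [set u in V | connect r z u].
have [/existsP[z /andP[zV big]]|/existsPn small] :=
    boolP [exists z, (z \in V) && (#|V| <= #|cls z|.*2)].
  have sV : cls z \subset V by apply/subsetP=> u; rewrite inE => /andP[].
  apply: (@cockayne_lorimer_module _ (cls z) z) => //.
  - by rewrite inE zV connect0.
  - move=> u w; rewrite !inE => /andP[uV zu] /andP[]; move=> + wV.
    rewrite wV /= => nzw; apply/esym.
    exact: (component_homogeneous zV wV zu nzw).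
  apply: IH; suff : #|cls z| < #|V| by lia.
  apply: proper_card; rewrite properE sV; apply/subsetPn.
  have [zx|zx] := boolP (connect r z x); last first.
    by exists x; rewrite // inE xV.
  exists y; rewrite // inE yV /=; apply: contra nxy => zy.
  by apply: connect_trans zy; rewrite rsym.
have leV W i : W \subset V -> color_matching i W <= color_matching i V.
  exact: matching_numberS.
(* Every class now has fewer than half of the vertices. Leaving [e] open serves both a = b and the
   union of two colors. *)
have half (e : rel T) : {in V &, forall u v, ~~ connect r u v -> e u v} ->
    has_matching e #|V|./2 V.
  move=> he; apply: (@has_matching_multipartite _ _ (root r)).
    by move=> u v uV vV; rewrite root_connect //; apply: he.
  move=> z zV; have := small z; rewrite zV /= -ltnNge => lt.
  have -> : [set u in V | root r u == root r z] = cls z.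
    by apply/setP=> u; rewrite !inE root_connect // rsym.
  by lia.
have [ab|ab] := eqVneq a b.
  have := half (fun u v => col u v == a).
  rewrite matching_numberE -/(color_matching a V) => h; exists a.
  rewrite (bigD1 a) //=; suff : #|V|./2 <= color_matching a V by lia.
  apply: h => u v uV vV nuv.
  by case: (color_across uV vV nuv) => ->; rewrite ?ab.
have : has_matching
    [rel u v | (fun u v => col u v == a) u v || (fun u v => col u v == b) u v]
    #|V|./2 V.
  apply: half => u v uV vV nuv /=.
  by case: (color_across uV vV nuv) => ->; rewrite eqxx ?orbT.
case/has_matching_or=> ma [mb [eqm]]; rewrite !matching_numberE.
rewrite -/(color_matching a V) -/(color_matching b V) => lea leb.
have sumab W : \sum_j color_matching j W = color_matching a W +
    (color_matching b W + \sum_(j | (j != a) && (j != b)) color_matching j W).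
  by rewrite (bigD1 a) //= (bigD1 b) //= eq_sym.
(* For such a [d], twice nu_d is at least nu_a + nu_b, so the right side is at least 2(nu_a + nu_b)
   + 1 >= |V|. *)
have [/existsP[d /and4P[da db ad bd]]|/existsPn others] :=
    boolP [exists d, [&& d != a, d != b, color_matching a V <= color_matching d V
                       & color_matching b V <= color_matching d V]].
  exists d; rewrite sumab (bigD1 d) ?da //=; lia.
(* Otherwise only [a] and [b] attain the maximal matching number; deleting an
   edge of each color that does lowers the maximum and the sum. *)
have remove_edge a' : color_matching a' V > 0 ->
    (forall d, d != a' -> color_matching d V < color_matching a' V) ->
    cockayne_lorimer V.
  move=> gt0 max; have := gt0.
  rewrite -matching_numberE => /has_matchingSP[u [v [uV vV uv cuv _]]].
  have lt : color_matching a' (V :\ u :\ v) < color_matching a' V.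
    exact: matching_number_setD_edge uV vV uv cuv _.
  have sW : V :\ u :\ v \subset V.
    by apply: subset_trans (subsetDl _ _) (subsetDl _ _).
  have cV := cardsD2 uV vV uv.
  have [i hi] : cockayne_lorimer (V :\ u :\ v).
    by apply: IH; clear - cV ltn; lia.
  exists a'; move: hi; rewrite cV (bigD1 a') //=.
  rewrite (bigD1 a' (F := fun j => color_matching j V)) //=.
  have : \sum_(j | j != a') color_matching j (V :\ u :\ v) <=
         \sum_(j | j != a') color_matching j V.
    by apply: leq_sum => j _; apply: leV.
  have : color_matching i (V :\ u :\ v) < color_matching a' V.
    have [->//|/max] := eqVneq i a'; exact: leq_ltn_trans (leV _ _ sW).
  by clear - lt; lia.
have [lt|gt|eqab] := ltngtP (color_matching a V) (color_matching b V).
- apply: (remove_edge b); first lia.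
  move=> d db; have [->//|da] := eqVneq d a.
  by have := others d; rewrite da db /=; lia.
- apply: (remove_edge a); first lia.
  move=> d da; have [->//|db] := eqVneq d b.
  by have := others d; rewrite da db /=; lia.
(* Two disjoint edges would cost four vertices. The path costs three, and pays for them: the sum
   drops by at least two and the maximum by at least one. *)
have [||u [v [w [[uV vV wV] [uv uw vw cuv cuw]]]]] := adjacent_edges xV yV nxy ab.
- by lia.
- by lia.
pose W := V :\ u :\ v :\ w.
have sWuv : W \subset V :\ u :\ v by apply: subsetDl.
have sWuw : W \subset V :\ u :\ w.
  by apply/subsetP=> z; rewrite !inE => /and4P[-> _ -> ->].
have sW : W \subset V.
  by apply: subset_trans sWuv _; apply: subset_trans (subsetDl _ _) (subsetDl _ _).
have lta : color_matching a W < color_matching a V.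
  by apply: matching_number_setD_edge uV vV uv _ sWuv; apply/eqP.
have ltb : color_matching b W < color_matching b V.
  by apply: matching_number_setD_edge uV wV uw _ sWuw; apply/eqP.
have cV : #|V| = #|W|.+3.
  rewrite (cardsD2 uV vV uv) (cardsD1 w) /W !inE wV.
  by rewrite ![w == _]eq_sym uw vw.
have [i hi] : cockayne_lorimer W by apply: IH; clear - cV ltn; lia.
exists a; rewrite cV; move: hi; rewrite !sumab.
have : \sum_(j | (j != a) && (j != b)) color_matching j W <=
       \sum_(j | (j != a) && (j != b)) color_matching j V.
  by apply: leq_sum => j _; apply: leV.
have : color_matching i W < color_matching a V.
  have [->//|ia] := eqVneq i a; have [->|ib] := eqVneq i b.
    by rewrite eqab.
  have := others i; have := leV _ i sW; rewrite ia ib -eqab andbb /=.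
  by rewrite -ltnNge; apply: leq_ltn_trans.
by clear - lta ltb; lia.
Qed.

End GallaiColorings.

(** * Edge colorings as functions on pairs of vertices *)

Lemma edge_of (N : nat) (x y : 'I_N) : x != y ->
  exists e : edge N, val e = [set x; y].
Proof.
move=> xy; have c2 : #|[set x; y]| == 2 by rewrite cards2 xy.
by exists (exist _ [set x; y] c2).
Qed.

Lemma edge_in_image (G : sgraph) N (f : {ffun G -> 'I_N}) (e : edge N) :
  reflect (exists x y, adj x y /\ val e = [set f x; f y])
          (e \in (image_graph f).2).
Proof.
rewrite inE; apply: (iffP existsP) => [[x /existsP[y /andP[axy /eqP ?]]]|].
  by exists x, y.
by move=> [x [y [axy /eqP exy]]]; exists x; apply/existsP; exists y; apply/andP.
Qed.

Lemma image_graph_edge (G : sgraph) N (f : {ffun G -> 'I_N}) (x y : G) :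
  injective f -> adj x y ->
  exists2 e, e \in (image_graph f).2 & val e = [set f x; f y].
Proof.
move=> inj_f axy; have [|e ee] := @edge_of N (f x) (f y).
  by apply/eqP => /inj_f xy; rewrite xy adj_irr in axy.
by exists e => //; apply/edge_in_image; exists x, y.
Qed.

Section EdgeColor.

Variables (k N : nat) (i0 : 'I_k) (c : coloring k N).

(* The value on the diagonal is the junk color [i0]. *)
Definition edge_color (x y : 'I_N) : 'I_k :=
  if (insub [set x; y] : option (edge N)) is Some e then c e else i0.

Lemma edge_colorE (e : edge N) x y : val e = [set x; y] -> edge_color x y = c e.
Proof. by move=> exy; rewrite /edge_color -exy valK. Qed.

Lemma edge_color_sym x y : edge_color x y = edge_color y x.
Proof. by rewrite /edge_color setUC. Qed.

Lemma edge_color_no_rainbow : rainbow_copies (complete_graph 3) c = set0 ->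
  forall x y z, x != y -> x != z -> y != z ->
  edge_color x y != edge_color x z ->
  edge_color y z = edge_color x y \/ edge_color y z = edge_color x z.
Proof.
move=> no x y z xy xz yz nxyz.
have [->|nyzx] := eqVneq (edge_color y z) (edge_color x y); first by left.
have [->|nyzz] := eqVneq (edge_color y z) (edge_color x z); first by right.
pose f : {ffun complete_graph 3 -> 'I_N} :=
  [ffun i : 'I_3 => tnth [tuple x; y; z] i].
suff : image_graph f \in rainbow_copies (complete_graph 3) c by rewrite no inE.
have fE (i : 'I_3) : f i = nth x [:: x; y; z] i.
  by rewrite ffunE (tnth_nth x).
rewrite inE; apply/andP; split.
  apply/imsetP; exists f => //; rewrite inE; apply/injectiveP => i j.
  rewrite !fE => /eqP; rewrite nth_uniq ?ltn_ord //=; first by move/eqP/val_inj.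
  by rewrite !inE negb_or xy xz yz.
have edgesE e : e \in (image_graph f).2 ->
    [\/ val e = [set x; y], val e = [set x; z] | val e = [set y; z]].
  move=> /edge_in_image[i [j [ij ->]]]; rewrite !fE.
  move: i j ij => [[|[|[|//]]] ?] [[|[|[|//]]] ?] //= _;
    by [apply: Or31|apply: Or32|apply: Or33|rewrite setUC; apply: Or31|
        rewrite setUC; apply: Or32|rewrite setUC; apply: Or33].
apply/forall_inP => e eS; apply/forall_inP => e' e'S; apply/implyP => /eqP ce.
rewrite -val_eqE /=.
have neq (u v u' v' : 'I_N) : edge_color u v != edge_color u' v' ->
    val e = [set u; v] -> val e' = [set u'; v'] -> val e == val e'.
  by move=> ne /edge_colorE E /edge_colorE E'; rewrite E E' ce eqxx in ne.
case: (edgesE e eS) (edgesE e' e'S) => [] E [] E'; do ?[by rewrite E E'];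
  by apply: neq E E'; rewrite // eq_sym.
Qed.

End EdgeColor.

(** * From matchings to monochromatic copies *)

(** Indexing by [nat] lets the induction put the new edge at index [m] without changing the type of
    [f]; values at indices from [m] on are junk, initially [x0]. *)
Lemma has_matching_embedding (T : finType) (x0 : T) (e : rel T) m (V : {set T}) :
  has_matching e m V -> exists f : nat -> bool -> T,
    [/\ forall i b, i < m -> f i b \in V,
        forall i j b b', i < m -> j < m -> f i b = f j b' -> i = j /\ b = b'
      & forall i, i < m -> e (f i false) (f i true)].
Proof.
elim: m V => [|m IH] V; first by exists (fun _ _ => x0).
move=> /has_matchingSP[x [y [xV yV xy exy /IH[f [fV finj fe]]]]].
exists (fun i b => if i == m then if b then y else x else f i b).
have ltm i : i < m.+1 -> i != m -> i < m by lia.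
have fV' i b : i < m.+1 -> i != m -> [/\ f i b \in V, f i b != x & f i b != y].
  by move=> im im'; have := fV i b (ltm i im im'); rewrite !inE => /and3P[-> -> ->].
split=> [i b im|i j b b' im jm|i im].
- by have [_|/(fV' i b im)[]//] := eqVneq i m; case: b.
- have [->|ni] := eqVneq i m; have [->|nj] := eqVneq j m => //.
  + by case: b b' => [] [] // e'; rewrite e' eqxx in xy.
  + by have [_ nx ny] := fV' j b' jm nj; case: b => e'; rewrite -e' eqxx in nx ny.
  + by have [_ nx ny] := fV' i b im ni; case: b' => e'; rewrite e' eqxx in nx ny.
  + by apply: finj; apply: ltm.
by have [//|/(ltm i im)/fe] := eqVneq i m.
Qed.

Lemma mono_copy_of_matching k N n (i0 i : 'I_k) (c : coloring k N)
    (V : {set 'I_N}) (x0 : 'I_N) :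
  n <= color_matching (edge_color i0 c) i V -> mono_copies (matching n) c != set0.
Proof.
rewrite -matching_numberE => /(has_matching_embedding x0)[f [_ finj fe]].
pose F : {ffun matching n -> 'I_N} := [ffun u : 'I_n * bool => f u.1 u.2].
have injF : injective F.
  move=> [i1 b1] [i2 b2]; rewrite !ffunE /=.
  by case/finj=> // /val_inj -> ->.
apply/set0Pn; exists (image_graph F); rewrite inE; apply/andP; split.
  by apply/imsetP; exists F => //; rewrite inE; apply/injectiveP.
have ci e : e \in (image_graph F).2 -> c e = i.
  move=> /edge_in_image[[i1 b1] [[i2 b2] [/andP[/= /eqP e12 b12]]]].
  rewrite !ffunE /= -e12 => E; rewrite -(edge_colorE i0 c E).
  have /eqP := fe i1 (ltn_ord i1).
  by case: b1 b2 b12 {E} => [] [] //= _; rewrite 1?edge_color_sym.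
by apply/forall_inP => e /ci ->; apply/forall_inP => e' /ci ->.
Qed.

(** If every color had matching number at most n - 1, the matching bound would give N <= 1 +
    (k+1)(n-1). *)
Lemma gallai_ramsey_upper k n N (c : coloring k N) : 0 < k -> 0 < n ->
  k.+1 * n.-1 + 2 <= N ->
  rainbow_copies (complete_graph 3) c != set0 \/ mono_copies (matching n) c != set0.
Proof.
move=> k0 n0 leN; have [/eqP no|] := boolP (rainbow_copies (complete_graph 3) c == set0);
  last by left.
right; pose i0 : 'I_k := Ordinal k0.
have x0 : 'I_N by apply: (@Ordinal N 0); apply: leq_trans leN; rewrite addn2.
have [i] := cockayne_lorimer_gallai (edge_color_sym i0 c)
              (@edge_color_no_rainbow _ _ i0 c no) i0 [set: 'I_N].
rewrite cardsT card_ord => hN.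
have [/existsP[j hj]|/existsPn small] :=
    boolP [exists j, n <= color_matching (edge_color i0 c) j [set: 'I_N]].
  exact: mono_copy_of_matching x0 hj.
have small' j : color_matching (edge_color i0 c) j [set: 'I_N] <= n.-1.
  by have := small j; lia.
have : \sum_j color_matching (edge_color i0 c) j [set: 'I_N] <= \sum_(j < k) n.-1.
  by apply: leq_sum.
by rewrite sum_nat_const card_ord; have := small' i; move: leN; rewrite mulSn; lia.
Qed.

(** * The layered coloring *)

Section LayeredColoring.

Variables (K d s N : nat).
Hypothesis d_gt0 : 0 < d.
Hypothesis s_gt0 : 0 < s.
Hypothesis N_def : N = s + K * d.

(** Layer 0 is the clique; the remaining vertices are cut into [K] blocks of [d]. In the application
    K = k - 1, d = n - 1, and [s] is 2n or 2n - 1. *)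
Definition layer (v : nat) : nat := if v < s then 0 else ((v - s) %/ d).+1.

Lemma layer_le (v : 'I_N) : layer v <= K.
Proof.
have : v < s + K * d by rewrite -N_def.
rewrite /layer => lt; case: (ltnP v s) => // le.
by rewrite ltn_divLR // ltn_subLR.
Qed.

Lemma layer_eq0 v : (layer v == 0) = (v < s).
Proof. by rewrite /layer; case: ltnP. Qed.

Definition layered_coloring : coloring K.+1 N :=
  [ffun e : edge N => inord (\max_(v in val e) layer v)].

Lemma layered_coloringE (e : edge N) x y : val e = [set x; y] ->
  layered_coloring e = maxn (layer x) (layer y) :> nat.
Proof.
move=> E; have xy : x != y.
  by have := valP e; rewrite E cards2; case: (x == y).
rewrite ffunE inordK; last by rewrite ltnS; apply/bigmax_leqP => v _; apply: layer_le.
by rewrite E big_setU1 ?inE //= big_set1.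
Qed.

Lemma layered_exact : 1 < s -> exact layered_coloring.
Proof.
move=> s1 i; have lt0 : 0 < N by lia.
(* The edge of color [i] joins vertex 0 to the first vertex of layer [i]; for color 0 it is the edge
   from 0 to 1 inside the clique. *)
have : (if i == 0 :> nat then 1 else s + i.-1 * d) < N.
  case: eqP => [_|i0]; first by lia.
  rewrite N_def ltn_add2l ltn_pmul2r //; have := ltn_ord i; lia.
move=> ltv; set v := (if _ then _ else _) in ltv.
have [|e E] := @edge_of N (Ordinal lt0) (Ordinal ltv).
  by rewrite -val_eqE neq_ltn /= /v; case: eqP => //= _; rewrite addn_gt0 s_gt0.
exists e; apply: val_inj; rewrite /= (layered_coloringE E) /= /layer s_gt0 max0n /v.
case: eqP => [->|i0]; first by rewrite s1.
rewrite ltnNge leq_addr /= addKn mulnK //; lia.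
Qed.

(** The two edges of a triangle at a vertex of its highest layer both get the color of that
    layer. *)
Lemma layered_no_rainbow :
  rainbow_copies (complete_graph 3) layered_coloring = set0.
Proof.
apply/eqP; rewrite -subset0; apply/subsetP => S.
rewrite inE => /andP[/imsetP[f /[!inE] /injectiveP injf ->]] rb.
pose o i : complete_graph 3 := inord i : 'I_3.
have neq i j : i < 3 -> j < 3 -> i != j -> o i != o j.
  by move=> i3 j3; apply: contraNneq => /(congr1 (@nat_of_ord 3));
     rewrite !inordK // => ->.
have rbE i j j' : i < 3 -> j < 3 -> j' < 3 -> i != j -> i != j' -> j != j' ->
    maxn (layer (f (o i))) (layer (f (o j))) <>
    maxn (layer (f (o i))) (layer (f (o j'))).
  move=> i3 j3 j'3 ij ij' jj'.
  have [e eS E] := image_graph_edge injf (neq _ _ i3 j3 ij).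
  have [e' e'S E'] := image_graph_edge injf (neq _ _ i3 j'3 ij').
  rewrite -(layered_coloringE E) -(layered_coloringE E') => /val_inj/eqP ee'.
  have /forall_inP/(_ e eS)/forall_inP/(_ e' e'S) := rb.
  rewrite ee' /= => /eqP ee.
  have : f (o j) \in val e' by rewrite -ee E !inE eqxx orbT.
  rewrite E' !inE => /orP[] /eqP/injf/eqP; apply/negP; apply: neq => //.
  by rewrite eq_sym.
have := rbE 0 1 2 isT isT isT isT isT isT.
have := rbE 1 0 2 isT isT isT isT isT isT.
have := rbE 2 0 1 isT isT isT isT isT isT.
by lia.
Qed.

(* A later layer has only [d] vertices and covers all edges of its color. *)
Lemma layered_mono_copies n S : d < n ->
  S \in mono_copies (matching n) layered_coloring ->
  exists f : {ffun matching n -> 'I_N},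
    [/\ S = image_graph f, injective f & forall u, f u < s].
Proof.
move=> dn; rewrite inE => /andP[/imsetP[f /[!inE] /injectiveP injf ->]] mono.
exists f; split=> // u.
pose ft (j : 'I_n) b := f ((j, b) : matching n).
have edge_j j : exists2 e, e \in (image_graph f).2 &
    val e = [set ft j false; ft j true].
  by apply: image_graph_edge; rewrite //= /matching_rel /= eqxx.
have [e0 e0S _] := edge_j u.1.
have maxE j : maxn (layer (ft j false)) (layer (ft j true)) = layered_coloring e0.
  have [e eS E] := edge_j j; rewrite -(layered_coloringE E).
  by have /forall_inP/(_ e eS)/forall_inP/(_ e0 e0S)/eqP-> := mono.
have [c0|cN0] := posnP (layered_coloring e0).
  rewrite -layer_eq0 -leqn0 -c0 -(maxE u.1) leq_max.
  by case: u {e0 e0S c0 maxE} => [j []]; rewrite /ft leqnn ?orbT.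
pose top j := layer (ft j true) == layered_coloring e0.
have topE j : layer (ft j (top j)) = layered_coloring e0.
  rewrite /top; case: eqP => // ne; have := maxE j; rewrite /maxn.
  by case: ltnP => // _ /ne.
(* The ends [top j] are distinct vertices of one layer, so their offsets in it would embed [n] edges
   into [d] positions. *)
have h_inj : injective (fun j => Ordinal (ltn_pmod (ft j (top j) - s) d_gt0)).
  move=> j j' /(congr1 val) /= emod.
  suff : ft j (top j) = ft j' (top j') by move/injf => [].
  apply: ord_inj; have := topE j; have := topE j'; rewrite /layer.
  case: ltnP => [|le']; first by lia.
  case: ltnP => [|le]; first by lia.
  move=> e' e; have [ediv] : ((ft j (top j) - s) %/ d).+1 =
    ((ft j' (top j') - s) %/ d).+1 by rewrite e e'.
  have : ft j (top j) - s = ft j' (top j') - s.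
    by rewrite (divn_eq (ft j _ - s) d) emod ediv -divn_eq.
  by lia.
have := leq_card _ h_inj; rewrite !card_ord; lia.
Qed.

End LayeredColoring.

(** * Counting the monochromatic copies *)

Lemma card_bigcup_le (I J : finType) (A : {pred I}) (F : I -> {set J}) m :
  (forall i, i \in A -> #|F i| <= m) -> #|\bigcup_(i in A) F i| <= #|A| * m.
Proof.
move=> leF; rewrite -sum_nat_const.
elim/big_ind2: _ => [|X n Y n' hX hY|i /leF//]; first by rewrite cards0.
by rewrite cardsU; apply: leq_trans (leq_subr _ _) (leq_add hX hY).
Qed.

Section PerfectMatchings.

Variable T : finType.

Definition perfect_matchings (W : {set T}) : {set {set {set T}}} :=
  [set P | partition P W & [forall e in P, #|e| == 2]].

(* The edge of a fixed vertex [x] can be chosen in [#|W| - 1] ways. *)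
Lemma card_perfect_matchings n (W : {set T}) : #|W| = 2 * n ->
  #|perfect_matchings W| <= double_factorial (2 * n - 1).
Proof.
elim: n W => [|n IH] W cW.
  have -> : W = set0 by apply: cards0_eq.
  apply: (@leq_trans #|[set set0 : {set {set T}}]|); last by rewrite cards1.
  apply/subset_leq_card/subsetP=> P; rewrite !inE => /andP[hP _].
  by rewrite partition_set0 in hP.
have [x xW] : exists x, x \in W by apply/card_gt0P; lia.
have cWx := cardsD1 x W; rewrite xW in cWx.
have sub : perfect_matchings W \subset \bigcup_(y in W :\ x)
    [set [set x; y] |: P | P in perfect_matchings (W :\ x :\ y)].
  apply/subsetP=> P; rewrite inE => /andP[partP /forall_inP c2].
  have covP : x \in cover P by rewrite (cover_partition partP).
  have eP := pblock_mem covP; set e := pblock P x in eP.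
  have xe : x \in e by rewrite mem_pblock.
  have /cards1P[y ey] : #|e :\ x| == 1.
    by have := cardsD1 x e; rewrite xe (eqP (c2 e eP)); lia.
  have eE : e = [set x; y] by rewrite -(setD1K xe) ey.
  have /setD1P[yx ye] : y \in e :\ x by rewrite ey inE.
  have yW : y \in W.
    by rewrite -(cover_partition partP); apply/bigcupP; exists e.
  apply/bigcupP; exists y; first by rewrite !inE yx yW.
  apply/imsetP; exists (P :\ e); last by rewrite -eE setD1K.
  rewrite inE; apply/andP; split; last first.
    by apply/forall_inP => e' /setD1P[_]; apply: c2.
  by have := partitionD1 partP eP; rewrite eE setDDl.
apply: leq_trans (subset_leq_card sub) _.
apply: leq_trans (card_bigcup_le (m := double_factorial (2 * n - 1)) _) _.
  move=> y /setD1P[yx yW]; apply: leq_trans (leq_imset_card _ _) _; apply: IH.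
  by have := cardsD2 xW yW; rewrite eq_sym yx => /(_ isT); lia.
have -> : #|W :\ x| = 2 * n + 1 by lia.
(* For [n] zero, truncated subtraction makes 2 * 0 - 1 equal to 0 and both sides are 1; the
   recursion of [double_factorial] applies only afterwards. *)
case: n {IH sub} cW cWx => [|n] _ _ //.
by have [-> ->] : 2 * n.+2 - 1 = (2 * n.+1 - 1).+2 /\ 2 * n.+1 + 1 = (2 * n.+1 - 1).+2
  by lia.
Qed.

End PerfectMatchings.

(** The clique has exactly as many vertices as a copy, so every monochromatic copy spans it. The
    copy is then determined by its edges, which form a perfect matching of [W]. *)
Lemma layered_mono_copies_le K d N : 0 < d -> N = 2 * d.+1 + K * d ->
  #|mono_copies (matching d.+1) (layered_coloring K d (2 * d.+1) N)| <=
  double_factorial (2 * d.+1 - 1).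
Proof.
move=> d0 NE; set s := 2 * d.+1 in NE *; set c := layered_coloring _ _ _ _.
pose W := [set v : 'I_N | v < s].
have cW : #|W| = s.
  have sN : s <= N by rewrite NE leq_addr.
  have -> : W = [set widen_ord sN i | i : 'I_s].
    apply/setP=> v; rewrite inE; apply/idP/imsetP => [vs|[i _ ->]]; last exact: (ltn_ord i).
    by exists (Ordinal vs) => //; apply: val_inj.
  rewrite card_imset ?card_ord // => i j /(congr1 val) /=; exact: val_inj.
apply: leq_trans (card_perfect_matchings cW).
have s0 : 0 < s by [].
have copyP S : S \in mono_copies (matching d.+1) c ->
    S.1 = W /\ [set val e | e in S.2] \in perfect_matchings W.
  move=> /(layered_mono_copies d0 s0 NE (ltnSn d))[f [-> injf fs]].
  have fW : [set f x | x : matching d.+1] = W.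
    apply/eqP; rewrite eqEcard cW card_imset // card_prod card_ord card_bool.
    rewrite mulnC leqnn andbT; apply/subsetP=> _ /imsetP[u _ ->].
    by rewrite inE.
  split=> //; pose ft (j : 'I_d.+1) b := f ((j, b) : matching d.+1).
  have edgesE : [set val e | e in (image_graph f).2] =
      [set [set ft j false; ft j true] | j : 'I_d.+1].
    apply/setP=> A; apply/imsetP/imsetP => [[e + ->]|[j _ ->]].
      move=> /edge_in_image[[j b] [[j' b'] [/andP[/= /eqP <- bb'] ->]]].
      by exists j => //; move: bb'; case: b b' => [] [] //= _; rewrite setUC.
    have [|e eS E] := @image_graph_edge _ _ f (j, false) (j, true) injf.
      by rewrite /= /matching_rel /= eqxx.
    by exists e.
  rewrite inE edgesE; apply/andP; split; last first.
    apply/forall_inP => _ /imsetP[j _ ->]; rewrite cards2.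
    by case: (ft j false =P ft j true) => // /injf [].
  apply/and3P; split.
  - rewrite -fW; apply/eqP/setP=> v; apply/bigcupP/imsetP.
      move=> [_ /imsetP[j _ ->]]; rewrite !inE => /orP[] /eqP ->.
        by exists (j, false).
      by exists (j, true).
    move=> [[j b] _ ->]; exists [set ft j false; ft j true].
      by apply/imsetP; exists j.
    by rewrite !inE; case: b; rewrite eqxx ?orbT.
  - apply/trivIsetP => _ _ /imsetP[j _ ->] /imsetP[j' _ ->] ne.
    rewrite -setI_eq0; apply/eqP/setP=> v; rewrite !inE; apply/negbTE/negP.
    have jj' : j != j' by apply: contraNneq ne => ->.
    by move=> /andP[/orP[] /eqP-> /orP[] /eqP/injf[] e];
      rewrite e eqxx in jj'.
  - apply/negP => /imsetP[j _ /setP/(_ (ft j false))].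
    by rewrite !inE eqxx.
have phi_inj : {in mono_copies (matching d.+1) c &,
    injective (fun S : subgraph N => [set val e | e in S.2])}.
  move=> [V E] [V' E'] /copyP[/= -> _] /copyP[/= -> _] /imset_inj -> //.
  exact: val_inj.
rewrite -(card_in_imset phi_inj); apply/subset_leq_card/subsetP=> _ /imsetP[S + ->].
by case/copyP.
Qed.

Lemma layered_mono_copies0 K d N : 0 < d -> N = (2 * d).+1 + K * d ->
  mono_copies (matching d.+1) (layered_coloring K d (2 * d).+1 N) = set0.
Proof.
move=> d0 NE; apply/eqP; rewrite -subset0; apply/subsetP=> S.
move=> /(layered_mono_copies d0 (ltn0Sn _) NE (ltnSn d))[f [_ injf fs]].
have h_inj : injective (fun u => Ordinal (fs u)).
  by move=> u v /(congr1 val) /= /ord_inj/injf.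
by have := leq_card _ h_inj; rewrite card_prod !card_ord card_bool; lia.
Qed.

(** * The Gallai-Ramsey number and the multiplicity *)

Theorem theorem3p10 (k n : nat) (hk : 6 <= k) (hn : 2 <= n) :
  exists g : nat,
    is_GM k (complete_graph 3) (matching n) g /\
    g <= double_factorial (2 * n - 1).
Proof.
case: k hk => // K hk; case: n hn => // d d0.
pose m := 2 * d.+1 + K * d; pose c0 := layered_coloring K d (2 * d.+1) m.
have exact_c0 : exact c0 by apply: layered_exact => //; lia.
pose exactb (c : coloring K.+1 m) := [forall i, exists e, c e == i].
have exactP c : reflect (exact c) (exactb c).
  apply: (iffP forallP) => h i; first by have /existsP[e /eqP] := h i; exists e.
  by apply/existsP; have [e /eqP] := h i; exists e.
have exactb_c0 : exactb c0 by apply/exactP.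
(* The multiplicity is the minimum over a finite set of colorings that contains [c0], so it exists
   and is at most the count for [c0]. *)
case: (arg_minnP (fun c => num_copies (complete_graph 3) (matching d.+1) c)
         exactb_c0) => c exact_c cmin.
exists (num_copies (complete_graph 3) (matching d.+1) c); split; last first.
  apply: leq_trans (cmin c0 exactb_c0) _; rewrite /num_copies.
  rewrite /c0 layered_no_rainbow // cards0.
  exact: layered_mono_copies_le.
have mE : m = K.+2 * d + 2 by rewrite /m; lia.
exists m; split; last first.
  split; first by exists c; split=> //; apply/exactP.
  by move=> c' /exactP; apply: cmin.
split.
  split=> [|N leN c' _]; last by apply: gallai_ramsey_upper => //; rewrite -mE.
  rewrite bin2 mE; nia.
move=> m' [_ bound]; rewrite leqNgt; apply/negP => lt.
(* A smaller bound would apply to m - 1 vertices, where the layered coloring with a clique on 2n - 1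
   vertices has neither kind of copy. *)
have le : m' <= m.-1 by lia.
have NE : m.-1 = (2 * d).+1 + K * d by rewrite /m; lia.
have ex : exact (layered_coloring K d (2 * d).+1 m.-1).
  by apply: layered_exact => //; lia.
have := bound _ le _ ex.
by rewrite layered_no_rainbow // layered_mono_copies0 // !eqxx; case.
Qed.
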